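(* Let $m\ge 1$ and let $\mathcal{S}$ be a finite set of quadratic Lyapunov inequalities over the alphabet $\{1,\dots,m\}$ in finitely many unknown functions $V_1,\dots,V_N$, and let $G$ be the directed labeled graph corresponding to $\mathcal{S}$. Then $\mathcal{S}$ is a sufficient condition for stability if and only if $G$ is path-complete.
   Context: Words and products. For an alphabet $\Sigma=\{1,\dots,m\}$, $\Sigma^*$ denotes the set of all finite words over $\Sigma$. Given square real matrices $A_1,\dots,A_m\in\mathbb{R}^{n\times n}$ and a word $w=w_1\dots w_t\in\Sigma^*$, put $A_w=A_{w_1}A_{w_2}\cdots A_{w_t}$. The mirror $\bar w$ of $w$ is the word $w_t\dots w_1$. Stability. The switched system defined by $\{A_1,\dots,A_m\}$ is $x_{k+1}=A_{\sigma(k)}x_k$, where $\sigma:\mathbb{N}\to\{1,\dots,m\}$ is an arbitrary switching signal. It (or the set of matrices) is called stable if it is globally uniformly asymptotically stable, i.e. all trajectories tend to zero for every switching signal; equivalently, the joint spectral radius $\rho=\lim_{k\to\infty}\max_{\sigma\in\{1,\dots,m\}^k}\|A_{\sigma_k}\cdots A_{\sigma_1}\|^{1/k}$ is smaller than $1$. Lyapunov inequalities. A quadratic Lyapunov inequality over $\{1,\dots,m\}$ in the unknowns $V_1,\dots,V_N$ is specified by a triple $(i,j,w)$ with $i,j\in\{1,\dots,N\}$ and $w$ a nonempty word over $\{1,\dots,m\}$; it stands for the requirement $$\forall x\in\mathbb{R}^n\setminus\{0\},\quad V_j(A_w x)<V_i(x),$$ where $V_1,\dots,V_N:\mathbb{R}^n\to\mathbb{R}$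 are positive definite quadratic forms, $V_i(x)=x^{T}P_ix$ with $P_i$ symmetric positive definite. Sufficient condition. A finite set $\mathcal{S}$ of such inequalities is a sufficient condition for stability if for every dimension $n\ge1$ and every $m$-tuple of matrices $A_1,\dots,A_m\in\mathbb{R}^{n\times n}$: whenever there exist positive definite quadratic forms $V_1,\dots,V_N$ on $\mathbb{R}^n$ satisfying all the inequalities in $\mathcal{S}$ for these matrices, the set $\{A_1,\dots,A_m\}$ is stable. Corresponding graph. The graph $G$ of $\mathcal{S}$ has nodes $1,\dots,N$ and, for each inequality $(i,j,w)\in\mathcal{S}$, an arc from $i$ to $j$ labeled with the mirror word $\bar w$. Path-completeness. A directed graph $G$ whose arcs are labeled with words from $\Sigma^*$ is path-complete if for every finite word $w_1\dots w_k\in\Sigma^*$ of any length $k$ there is a directed path in $G$ such that the word obtained by concatenating the labels of the arcs along this path contains $w_1\dots w_k$ as a subword (block of consecutive letters). *)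

(* Defs.v *)
From HB Require Import structures.
From mathcomp Require Import all_boot all_order all_algebra.
From mathcomp Require Import finmap.
From mathcomp Require Import all_classical all_reals all_analysis.
Set Implicit Arguments.
Unset Strict Implicit.
Unset Printing Implicit Defensive.
Import Order.TTheory GRing.Theory Num.Theory.
Import numFieldNormedType.Exports.
Local Open Scope ring_scope.
Local Open Scope classical_set_scope.

(* The alphabet {1, ..., m} is 'I_m.  Product in reading order:
   word_mx A [:: a; b; c] = A a *m A b *m A c. *)
Definition word_mx (R : realType) (m n : nat) (A : 'I_m -> 'M[R]_n)
    (w : seq 'I_m) : 'M[R]_n :=
  \big[mulmx/1%:M]_(a <- w) A a.

Fixpoint trajectory (R : realType) (m n : nat) (A : 'I_m -> 'M[R]_n)
    (sigma : nat -> 'I_m) (x0 : 'cV[R]_n) (k : nat) : 'cV[R]_n :=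
  if k is k'.+1 then A (sigma k') *m trajectory A sigma x0 k' else x0.

Definition stable (R : realType) (m n : nat) (A : 'I_m -> 'M[R]_n) : Prop :=
  forall (sigma : nat -> 'I_m) (x0 : 'cV[R]_n),
    trajectory A sigma x0 @ \oo --> (0 : 'cV[R]_n).

Definition quad_form (R : realType) (n : nat) (P : 'M[R]_n) (x : 'cV[R]_n) : R :=
  (x^T *m P *m x) 0 0.

Definition posdefmx (R : realType) (n : nat) (P : 'M[R]_n) : Prop :=
  P^T = P /\ forall x : 'cV[R]_n, x != 0 -> 0 < quad_form P x.

(* The inequality V_j (A_w x) < V_i x is the triple (i, j, w). *)
Definition ineq_holds (R : realType) (N m n : nat) (A : 'I_m -> 'M[R]_n)
    (P : 'I_N -> 'M[R]_n) (s : 'I_N * 'I_N * seq 'I_m) : Prop :=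
  let: (i, j, w) := s in
  forall x : 'cV[R]_n, x != 0 ->
    quad_form (P j) (word_mx A w *m x) < quad_form (P i) x.

Definition sufficient_condition (R : realType) (N m : nat)
    (S : {fset 'I_N * 'I_N * seq 'I_m}) : Prop :=
  forall (n : nat) (A : 'I_m -> 'M[R]_n), (0 < n)%N ->
    (exists P : 'I_N -> 'M[R]_n,
        (forall i, posdefmx (P i)) /\ (forall s, s \in S -> ineq_holds A P s)) ->
    stable A.

(* A labeled directed graph is its finite set of arcs (source, target, label). *)
Definition ineq_graph (N m : nat) (S : {fset 'I_N * 'I_N * seq 'I_m}) :
    {fset 'I_N * 'I_N * seq 'I_m} :=
  [fset (s.1.1, s.1.2, rev s.2) | s in S]%fset.

(* A path is its list of consecutive arcs; the empty list reads the empty word. *)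
Definition directed_path (N m : nat) (G : {fset 'I_N * 'I_N * seq 'I_m})
    (p : seq ('I_N * 'I_N * seq 'I_m)) : Prop :=
  {subset p <= G} /\ sorted (fun e f => e.1.2 == f.1.1) p.

Definition path_word (N m : nat) (p : seq ('I_N * 'I_N * seq 'I_m)) : seq 'I_m :=
  flatten [seq e.2 | e <- p].

Definition path_complete (N m : nat) (G : {fset 'I_N * 'I_N * seq 'I_m}) : Prop :=
  forall w : seq 'I_m,
    exists p, directed_path G p /\ infix w (path_word p).

(* Main.v *)
(* If the graph is path-complete, every product of matrices is, up to a bounded
   prefix and suffix, a product along a path of the graph. By compactness every
   arc contracts the quadratic forms by a common factor smaller than 1, so long
   products tend to 0.

   Conversely, let w = w_0 ... w_(n-1) be a word that no path contains. On R^n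
   let A_a map the basis vector e_i to e_(i+1 mod n) if w_i = a, and to 0
   otherwise. Reading w w w ... moves e_0 around the cycle for ever, so the
   system is unstable. But a word u with A_u <> 0 is a factor of w w w ..., and
   contains w once its length is at least 2n; hence the products along all paths
   of 2n + 1 arcs vanish, and V_i(x) = sum of |A_p x|^2 over all paths p from
   node i is a finite sum. The paths from i through an arc i -> j account for
   V_j, and the empty path adds |x|^2, which makes the inequalities strict. *)
Require Import Defs.
From HB Require Import structures.
From mathcomp Require Import all_boot all_order all_algebra.
From mathcomp Require Import finmap.
From mathcomp Require Import all_classical all_reals all_analysis.
From mathcomp Require Import lra zify.
Set Implicit Arguments.
Unset Strict Implicit.
Unset Printing Implicit Defensive.
Import Order.TTheory GRing.Theory Num.Theory.
Import numFieldNormedType.Exports.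
Local Open Scope ring_scope.
Local Open Scope classical_set_scope.

Lemma quad_formD (R : realType) n (P Q : 'M[R]_n) x :
  quad_form (P + Q) x = quad_form P x + quad_form Q x.
Proof. by rewrite /quad_form mulmxDr mulmxDl mxE. Qed.

Lemma quad_formB (R : realType) n (P Q : 'M[R]_n) x :
  quad_form (P - Q) x = quad_form P x - quad_form Q x.
Proof. by rewrite /quad_form mulmxBr mulmxBl !mxE. Qed.

Lemma quad_form_sum (R : realType) n (I : Type) (r : seq I) (C : pred I)
    (P : I -> 'M[R]_n) x :
  quad_form (\sum_(i <- r | C i) P i) x = \sum_(i <- r | C i) quad_form (P i) x.
Proof. by rewrite /quad_form mulmx_sumr mulmx_suml summxE. Qed.

Lemma quad_form_congr (R : realType) n (P B : 'M[R]_n) x :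
  quad_form (B^T *m P *m B) x = quad_form P (B *m x).
Proof. by rewrite /quad_form trmx_mul !mulmxA. Qed.

Lemma quad_formZv (R : realType) n (P : 'M[R]_n) (c : R) x :
  quad_form P (c *: x) = c ^+ 2 * quad_form P x.
Proof.
rewrite /quad_form [(c *: x)^T]linearZ -scalemxAr -!scalemxAl !mxE.
by rewrite expr2 mulrA.
Qed.

Lemma quad_form0 (R : realType) n (P : 'M[R]_n) : quad_form P 0 = 0.
Proof. by rewrite /quad_form mulmx0 mxE. Qed.

Lemma quad_form1E (R : realType) n (x : 'cV[R]_n) :
  quad_form 1%:M x = \sum_i x i 0 ^+ 2.
Proof.
by rewrite /quad_form mulmx1 mxE; apply: eq_bigr => i _; rewrite mxE expr2.
Qed.

Lemma quad_form1_ge0 (R : realType) n (x : 'cV[R]_n) : 0 <= quad_form 1%:M x.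
Proof. by rewrite quad_form1E sumr_ge0 // => i _; exact: sqr_ge0. Qed.

Lemma sqr_norm_le_quad_form1 (R : realType) n (x : 'cV[R]_n) :
  `|x| ^+ 2 <= quad_form 1%:M x.
Proof.
have [|x0] := eqVneq (`|x|) 0.
  by move=> ->; rewrite expr0n quad_form1_ge0.
have [[i j] xij] := mx_norm_neq0 x0.
rewrite /Num.norm /= xij quad_form1E /= (bigD1 i) //= (ord1 j).
rewrite real_normK ?num_real //.
by rewrite lerDl sumr_ge0 // => k _; exact: sqr_ge0.
Qed.

Lemma quad_form1_gt0 (R : realType) n (x : 'cV[R]_n) :
  x != 0 -> 0 < quad_form 1%:M x.
Proof.
move=> x0; apply: lt_le_trans (sqr_norm_le_quad_form1 x).
by rewrite exprn_gt0 // normr_gt0.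
Qed.

Lemma quad_form_tr_continuous (R : realType) n (P : 'M[R]_n) :
  continuous (fun u : 'rV[R]_n => quad_form P u^T).
Proof.
rewrite (_ : (fun u : 'rV[R]_n => _) =
    fun u : 'rV[R]_n => \sum_j ((\sum_i u 0 i * P i j) * u 0 j)); last first.
  by apply/funext => u; rewrite /quad_form trmxK mxE; apply: eq_bigr => j _;
    rewrite !mxE.
have row_cont j : continuous (fun u : 'rV[R]_n => \sum_i u 0 i * P i j).
  apply: continuous_big => [|i _ u]; first exact: add_continuous.
  by apply: continuousM; [exact: coord_continuous|exact: cst_continuous].
apply: continuous_big => [|j _ u]; first exact: add_continuous.
by apply: continuousM; [exact: row_cont|exact: coord_continuous].
Qed.

Lemma quad_form_le_posdef (R : realType) n (P Q : 'M[R]_n) :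
  (forall x, x != 0 -> 0 < quad_form P x) ->
  exists2 c, 1 <= c & forall x, quad_form Q x <= c * quad_form P x.
Proof.
move=> Ppos.
pose A : set 'rV[R]_n := [set u | `|u| = 1].
have scaleA x : x != 0 -> A (`|x^T|^-1 *: x^T).
  move=> x0; rewrite /A /= normrZ normfV normr_id mulVf // normr_eq0.
  by apply: contra_neq x0 => /(congr1 trmx); rewrite trmxK trmx0.
have [A0|A0] := pselect (A !=set0); last first.
  exists 1 => // x; have [->|x0] := eqVneq x 0.
    by rewrite !quad_form0 mulr0.
  by case: A0; exists (`|x^T|^-1 *: x^T); exact: scaleA.
have cA : compact A.
  apply: bounded_closed_compact.
    by exists 1; split => // M M1 u /= ->; exact: ltW.
  rewrite (_ : A = Num.norm @^-1` [set 1 : R]) //.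
  apply: closed_comp => [u _|]; [exact: norm_continuous|exact: closed_eq].
have Ppos' u : A u -> 0 < quad_form P u^T.
  move=> Au; apply: Ppos; apply: contra_eq_neq Au => /(congr1 trmx).
  by rewrite trmxK trmx0 => ->; rewrite normr0 eq_sym oner_neq0.
have [|u _ umax] := @compact_EVT_max _ _
    (fun u => quad_form Q u^T / quad_form P u^T) A A0 cA.
  apply: continuous_in_subspaceT => u /set_mem Au.
  have Pu0 : quad_form P u^T != 0 by rewrite gt_eqF // Ppos'.
  pose qQ (v : 'rV[R]_n) := quad_form Q v^T.
  pose qP (v : 'rV[R]_n) := quad_form P v^T.
  apply: (@continuousM _ _ qQ (fun v => (qP v)^-1)).
    exact: quad_form_tr_continuous.
  by apply: (@continuousV _ _ qP) => //; exact: quad_form_tr_continuous.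
exists (Num.max 1 (quad_form Q u^T / quad_form P u^T)).
  by rewrite le_max lexx.
move=> x; have [->|x0] := eqVneq x 0; first by rewrite !quad_form0 mulr0.
have Ax := scaleA x x0; have /umax := mem_set Ax.
rewrite ler_pdivrMr ?Ppos' // linearZ /= trmxK !quad_formZv mulrCA.
have s_gt0 : 0 < `|x^T|^-1.
  rewrite invr_gt0 normr_gt0.
  by apply: contra_neq x0 => /(congr1 trmx); rewrite trmxK trmx0.
rewrite ler_pM2l ?exprn_gt0 //.
move=> le_u; apply: le_trans le_u _.
by apply: ler_wpM2r; [exact: ltW (Ppos _ x0)|rewrite le_max lexx orbT].
Qed.

Lemma quad_form_lt_contraction (R : realType) n (P Q : 'M[R]_n) :
  (forall x, x != 0 -> 0 < quad_form P x) ->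
  (forall x, x != 0 -> quad_form Q x < quad_form P x) ->
  exists2 g, 0 < g < 1 & forall x, quad_form Q x <= g * quad_form P x.
Proof.
move=> Ppos QltP.
have [x x0|c c1 Pc] := @quad_form_le_posdef _ _ (P - Q) P.
  by rewrite quad_formB subr_gt0 QltP.
have c0 : 0 < c by lra.
have P_ge0 x : 0 <= quad_form P x.
  by have [->|/Ppos/ltW//] := eqVneq x 0; rewrite quad_form0.
have h01 : 0 < (c + 1)^-1 < 1 by rewrite invr_gt0 invf_lt1; lra.
exists (1 - (c + 1)^-1); first lra.
move=> x; rewrite mulrBl mul1r -subr_ge0.
suff H : 0 <= (c + 1) * (quad_form P x - quad_form Q x) - quad_form P x.
  have : 0 <= (c + 1)^-1 * ((c + 1) * (quad_form P x - quad_form Q x)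
                            - quad_form P x) by apply: mulr_ge0 => //; lra.
  rewrite mulrBr mulrA mulVf ?mul1r; lra.
by have := Pc x; have := P_ge0 x; rewrite quad_formB; nra.
Qed.

(* Labels and paths read letters in the order in which they are applied, so the
   word [u] acts through the mirror product. *)
Definition run_mx (R : realType) (m n : nat) (A : 'I_m -> 'M[R]_n)
  (u : seq 'I_m) : 'M[R]_n := word_mx A (rev u).

Lemma run_mx_nil (R : realType) m n (A : 'I_m -> 'M[R]_n) :
  run_mx A [::] = 1%:M.
Proof. by rewrite /run_mx /word_mx big_nil. Qed.

Lemma run_mx_cat (R : realType) m n (A : 'I_m -> 'M[R]_n) u v :
  run_mx A (u ++ v) = run_mx A v *m run_mx A u.
Proof.
rewrite /run_mx rev_cat; move: (rev u) (rev v) => {}u {}v.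
elim: v => [|a v IH]; rewrite /word_mx; first by rewrite big_nil mul1mx.
by rewrite cat_cons !big_cons -mulmxA -[in RHS]IH.
Qed.

Lemma run_mx_cons (R : realType) m n (A : 'I_m -> 'M[R]_n) a u :
  run_mx A (a :: u) = run_mx A u *m A a.
Proof.
by rewrite -cat1s run_mx_cat /run_mx /word_mx big_cons big_nil mulmx1.
Qed.

Lemma trajectoryE (R : realType) m n (A : 'I_m -> 'M[R]_n) sigma x k :
  trajectory A sigma x k = run_mx A (mkseq sigma k) *m x.
Proof.
elim: k => [|k /= ->]; first by rewrite /= run_mx_nil mul1mx.
by rewrite mkseqS -cats1 run_mx_cat run_mx_cons run_mx_nil mul1mx mulmxA.
Qed.

Lemma quad_form1_run_mx_le (R : realType) m n (A : 'I_m -> 'M[R]_n) L :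
  exists2 M, 1 <= M & forall u x, (size u <= L)%N ->
    quad_form 1%:M (run_mx A u *m x) <= M * quad_form 1%:M x.
Proof.
have /choice[B HB] (a : 'I_m) : exists c, 1 <= c /\ forall x,
    quad_form 1%:M (A a *m x) <= c * quad_form 1%:M x.
  have [c c1 H] := @quad_form_le_posdef _ _ 1%:M ((A a)^T *m 1%:M *m A a)
    (@quad_form1_gt0 R n).
  by exists c; split => // x; rewrite -quad_form_congr.
pose b := \big[Num.max/1]_a B a.
have b1 : 1 <= b by exact: bigmax_ge_id.
exists (b ^+ L); first exact: exprn_ege1.
suff run_le u x :
    quad_form 1%:M (run_mx A u *m x) <= b ^+ size u * quad_form 1%:M x.
  move=> u x uL; apply: le_trans (run_le u x) _.
  by apply: ler_wpM2r; [exact: quad_form1_ge0|exact: ler_weXn2l].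
elim: u x => [|a u IH] x; first by rewrite run_mx_nil mul1mx mul1r.
rewrite run_mx_cons -mulmxA; apply: le_trans (IH _) _.
rewrite exprSr -mulrA ler_wpM2l ?exprn_ge0 ?(le_trans _ b1) //.
apply: le_trans ((HB a).2 x) _.
by apply: ler_wpM2r; [exact: quad_form1_ge0|exact: le_bigmax].
Qed.

Lemma prefix_path_decay (R : realType) N m n (A : 'I_m -> 'M[R]_n)
    (G : {fset 'I_N * 'I_N * seq 'I_m}) (V : 'I_N -> 'cV[R]_n -> R) L M C g :
  0 <= M -> 0 <= g ->
  (forall e, e \in G -> (size e.2 <= L)%N) ->
  (forall u x, (size u <= L)%N ->
    quad_form 1%:M (run_mx A u *m x) <= M * quad_form 1%:M x) ->
  (forall i x, quad_form 1%:M x <= C * V i x) ->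
  (forall e x, e \in G -> V e.1.2 (run_mx A e.2 *m x) <= g * V e.1.1 x) ->
  0 <= C ->
  forall e p t, directed_path G (e :: p) -> exists2 k,
    (size (take t (path_word (e :: p))) <= k.+1 * L)%N &
    forall x, quad_form 1%:M (run_mx A (take t (path_word (e :: p))) *m x)
      <= M * C * g ^+ k * V e.1.1 x.
Proof.
move=> M0 g0 GL ML qV Vg C0 e p t [].
have short e' u : (size u <= L)%N -> exists2 k, (size u <= k.+1 * L)%N &
    forall x, quad_form 1%:M (run_mx A u *m x) <= M * C * g ^+ k * V e' x.
  move=> uL; exists 0%N => [|x]; first by rewrite mul1n.
  rewrite expr0 mulr1 -mulrA; apply: le_trans (ML _ _ uL) _.
  exact: ler_wpM2l.
elim: p e t => [|f p IH] e t sub srt.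
  apply: short; rewrite /path_word /= cats0 size_take_min.
  by rewrite geq_min GL ?orbT // sub ?mem_head.
have eL : (size e.2 <= L)%N by rewrite GL // sub ?mem_head.
rewrite {1 2}/path_word /= -/(path_word (f :: p)) take_cat; case: ifP => _.
  by apply: short; rewrite size_take_min geq_min eL orbT.
move: srt => /= /andP[/eqP ef srt].
have [|k kw IHx] := IH f (t - size e.2)%N _ srt.
  by move=> h hp; rewrite sub // inE hp orbT.
exists k.+1 => [|x]; first by rewrite size_cat mulSn leq_add.
rewrite run_mx_cat -mulmxA; apply: le_trans (IHx _) _.
rewrite exprSr mulrA -[leRHS]mulrA ler_wpM2l ?mulr_ge0 ?exprn_ge0 //.
by rewrite -ef Vg // sub ?mem_head.
Qed.

(* A block of consecutive letters of a path word is a suffix of one label,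
   followed by complete labels, followed by a prefix of a label: only the two
   incomplete labels escape the contraction by [g]. *)
Lemma infix_path_decay (R : realType) N m n (A : 'I_m -> 'M[R]_n)
    (G : {fset 'I_N * 'I_N * seq 'I_m}) (V : 'I_N -> 'cV[R]_n -> R) L M C g :
  1 <= M -> 1 <= C -> 0 <= g ->
  (forall e, e \in G -> (size e.2 <= L)%N) ->
  (forall u x, (size u <= L)%N ->
    quad_form 1%:M (run_mx A u *m x) <= M * quad_form 1%:M x) ->
  (forall i x, quad_form 1%:M x <= C * V i x) ->
  (forall i x, V i x <= C * quad_form 1%:M x) ->
  (forall e x, e \in G -> V e.1.2 (run_mx A e.2 *m x) <= g * V e.1.1 x) ->
  forall p w, directed_path G p -> infix w (path_word p) -> exists2 k,
    (size w <= k.+2 * L)%N &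
    forall x, quad_form 1%:M (run_mx A w *m x)
      <= M * C * g ^+ k * (C * (M * quad_form 1%:M x)).
Proof.
move=> M1 C1 g0 GL ML qV Vq Vg p w [].
have M0 : 0 <= M by exact: le_trans M1.
have C0 : 0 <= C by exact: le_trans C1.
have short u : (size u <= L)%N -> exists2 k, (size u <= k.+2 * L)%N &
    forall x, quad_form 1%:M (run_mx A u *m x)
      <= M * C * g ^+ k * (C * (M * quad_form 1%:M x)).
  move=> uL; exists 0%N => [|x]; first by apply: leq_trans uL _; lia.
  rewrite expr0 mulr1; apply: le_trans (ML _ _ uL) _.
  rewrite [leRHS]mulrA -[leLHS]mul1r.
  by rewrite ler_wpM2r ?mulr_ge0 ?quad_form1_ge0 // !mulr_ege1.
move=> sub srt /infixP[s [s' E]].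
have -> : w = take (size w) (drop (size s) (path_word p)).
  by rewrite E drop_size_cat // take_size_cat.
move: (size s) (size w) => d t {E s s' w}.
elim: p d sub srt => [|e p IH] d sub srt.
  by apply: short; rewrite /path_word.
have eL : (size e.2 <= L)%N by rewrite GL // sub ?mem_head.
have sub' : {subset p <= G} by move=> h hp; rewrite sub // inE hp orbT.
rewrite /path_word /= -/(path_word p) drop_cat; case: ifP => _; last first.
  by apply: IH => //; exact: path_sorted srt.
have cL : (size (drop d e.2) <= L)%N.
  by rewrite size_drop; apply: leq_trans eL; exact: leq_subr.
rewrite take_cat; case: ifP => _.
  by apply: short; rewrite size_take_min geq_min cL orbT.
case: p sub' srt {IH sub} => [|f p] sub' srt.
  by apply: short; rewrite /path_word /= cats0.
have [|k kw H] := @prefix_path_decay _ _ _ _ A G V L M C g M0 g0 GL ML qV Vg C0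
  f p (t - size (drop d e.2))%N.
  by split => //; exact: path_sorted srt.
exists k => [|x]; first by rewrite size_cat mulSn leq_add.
rewrite run_mx_cat -mulmxA; apply: le_trans (H _) _.
rewrite ler_wpM2l ?mulr_ge0 ?exprn_ge0 //.
apply: le_trans (Vq _ _) _; rewrite ler_wpM2l //.
exact: ML.
Qed.

Lemma path_complete_sufficient (R : realType) m N
    (S : {fset 'I_N * 'I_N * seq 'I_m}) :
  path_complete (ineq_graph S) -> sufficient_condition R S.
Proof.
move=> pc n A _ [P [Ppos SP]] sigma y.
set G := ineq_graph S in pc.
pose V i x := quad_form (P i) x.
pose L := (\max_(e : G) size (val e).2)%N.
have GL e : e \in G -> (size e.2 <= L)%N.
  move=> eG.
  exact: (leq_bigmax (F := fun e : G => size (val e).2) [` eG]%fset).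
have [M M1 ML] := quad_form1_run_mx_le A L.
have /choice[C1 HC1] (i : 'I_N) : exists c, forall x,
    V i x <= c * quad_form 1%:M x.
  by have [c _ H] := quad_form_le_posdef (P i) (@quad_form1_gt0 R n); exists c.
have /choice[C2 HC2] (i : 'I_N) : exists c, forall x,
    quad_form 1%:M x <= c * V i x.
  by have [c _ H] := quad_form_le_posdef 1%:M (Ppos i).2; exists c.
have V0 i x : 0 <= V i x.
  rewrite /V; have [->|/(Ppos i).2/ltW//] := eqVneq x 0.
  by rewrite quad_form0.
pose C := \big[Num.max/1]_i Num.max (C1 i) (C2 i).
have C_ge1 : 1 <= C by exact: bigmax_ge_id.
have C_ge i : Num.max (C1 i) (C2 i) <= C by exact: le_bigmax.
have Vq i x : V i x <= C * quad_form 1%:M x.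
  apply: le_trans (HC1 i x) _; rewrite ler_wpM2r ?quad_form1_ge0 //.
  by rewrite (le_trans _ (C_ge i)) // le_max lexx.
have qV i x : quad_form 1%:M x <= C * V i x.
  apply: le_trans (HC2 i x) _; rewrite ler_wpM2r //.
  by rewrite (le_trans _ (C_ge i)) // le_max lexx orbT.
have /choice[g Hg] (e : G) : exists g, 0 < g < 1 /\ forall x,
    V (val e).1.2 (run_mx A (val e).2 *m x) <= g * V (val e).1.1 x.
  case: e => e /= /imfsetP[/= [[i j] u] /SP Su ->] /=.
  rewrite /run_mx revK; pose B := word_mx A u.
  have [x x0|h h01 H] := @quad_form_lt_contraction _ _ (P i) (B^T *m P j *m B)
    (Ppos i).2.
    by rewrite quad_form_congr; exact: Su.
  by exists h; split => // x; rewrite /V -quad_form_congr.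
pose gm := \big[Num.max/2^-1]_e g e.
have gm0 : 0 < gm.
  by apply: lt_le_trans (bigmax_ge_id _ _ _ _); rewrite invr_gt0.
have gm1 : gm < 1.
  by apply: bigmax_lt => [|e _]; [rewrite invf_lt1 ?ltr1n|case/andP: (Hg e).1].
have Vg e x : e \in G -> V e.1.2 (run_mx A e.2 *m x) <= gm * V e.1.1 x.
  move=> eG; apply: le_trans ((Hg [` eG]%fset).2 x) _.
  by rewrite ler_wpM2r // le_bigmax.
have decay w : exists2 k, (size w <= k.+2 * L)%N & forall x,
    quad_form 1%:M (run_mx A w *m x)
      <= M * C * gm ^+ k * (C * (M * quad_form 1%:M x)).
  have [p [Gp wp]] := pc w.
  exact: (infix_path_decay M1 C_ge1 (ltW gm0) GL ML qV Vq Vg Gp wp).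
apply/cvgr0Pnorm_lt => eps eps0.
pose D := M * C * (C * (M * quad_form 1%:M y)).
have D0 : 0 <= D.
  by rewrite !mulr_ge0 ?quad_form1_ge0 // ?(le_trans _ M1) ?(le_trans _ C_ge1).
have gm_cvg : GRing.exp gm @ \oo --> (0 : R).
  by apply: cvg_expr; rewrite ger0_norm // ltW.
have /cvgr0Pnorm_lt/(_ (eps ^+ 2 / (D + 1))) := gm_cvg.
case=> [|J _ HJ]; first by rewrite divr_gt0 ?exprn_gt0 // ltr_wpDl.
exists (J.+2 * L).+1 => // k /= kJ.
have [j kj Hj] := decay (mkseq sigma k).
have {kj} Jj : (J <= j)%N by move: kj; rewrite size_mkseq; nia.
rewrite -(@ltr_pXn2r _ 2) ?nnegrE ?(ltW eps0) ?normr_ge0 //.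
apply: le_lt_trans (sqr_norm_le_quad_form1 _) _.
rewrite trajectoryE; apply: le_lt_trans (Hj y) _.
have := HJ j Jj; rewrite /= ger0_norm ?exprn_ge0 ?(ltW gm0) //.
rewrite ltr_pdivlMr; last by rewrite ltr_wpDl.
apply: le_lt_trans; rewrite mulrAC -/D mulrC ler_wpM2l ?exprn_ge0 ?(ltW gm0) //.
by rewrite lerDl.
Qed.

(* [path_form A G k i] is the matrix of the sum of [|A_p x|^2] over the paths
   [p] of [G] with at most [k] arcs that start at [i]. *)
Fixpoint path_form (R : realType) N m n (A : 'I_m -> 'M[R]_n)
    (G : {fset 'I_N * 'I_N * seq 'I_m}) (k : nat) (i : 'I_N) : 'M[R]_n :=
  if k is k'.+1 then
    1%:M + \sum_(e <- G | e.1.1 == i)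
             (run_mx A e.2)^T *m path_form A G k' e.1.2 *m run_mx A e.2
  else 1%:M.

Lemma quad_path_formS (R : realType) N m n (A : 'I_m -> 'M[R]_n)
    (G : {fset 'I_N * 'I_N * seq 'I_m}) k i x :
  quad_form (path_form A G k.+1 i) x = quad_form 1%:M x +
    \sum_(e <- G | e.1.1 == i)
      quad_form (path_form A G k e.1.2) (run_mx A e.2 *m x).
Proof.
rewrite /= quad_formD quad_form_sum; congr (_ + _).
by apply: eq_bigr => e _; exact: quad_form_congr.
Qed.

Lemma quad_path_form_ge0 (R : realType) N m n (A : 'I_m -> 'M[R]_n)
    (G : {fset 'I_N * 'I_N * seq 'I_m}) k i x :
  0 <= quad_form (path_form A G k i) x.
Proof.
elim: k i x => [|k IH] i x; first exact: quad_form1_ge0.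
by rewrite quad_path_formS addr_ge0 ?quad_form1_ge0 ?sumr_ge0.
Qed.

Lemma path_form_posdef (R : realType) N m n (A : 'I_m -> 'M[R]_n)
    (G : {fset 'I_N * 'I_N * seq 'I_m}) k i : posdefmx (path_form A G k i).
Proof.
split.
  elim: k i => [|k IH] i; first exact: trmx1.
  rewrite /= linearD /= trmx1 linear_sum /=; congr (_ + _).
  by apply: eq_bigr => e _; rewrite !trmx_mul trmxK IH mulmxA.
move=> x /quad_form1_gt0 q0; case: k => [//|k].
rewrite quad_path_formS ltr_pwDl // sumr_ge0 // => e _.
exact: quad_path_form_ge0.
Qed.

Lemma quad_path_form_stationary (R : realType) N m n (A : 'I_m -> 'M[R]_n)
    (G : {fset 'I_N * 'I_N * seq 'I_m}) k i x :
  (forall e p, directed_path G (e :: p) -> e.1.1 = i -> size p = k ->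
    run_mx A (path_word (e :: p)) *m x = 0) ->
  quad_form (path_form A G k.+1 i) x = quad_form (path_form A G k i) x.
Proof.
elim: k i x => [|k IH] i x H.
  rewrite quad_path_formS /= big_seq_cond big1 ?addr0 // => e /andP[eG /eqP ei].
  have := H e [::]; rewrite /path_word /= cats0 => -> //.
    by rewrite quad_form0.
  by split => // f; rewrite inE => /eqP ->.
rewrite 2!quad_path_formS; congr (_ + _).
rewrite big_seq_cond [in RHS]big_seq_cond.
apply: eq_bigr => e /andP[eG /eqP ei].
apply: IH => f p [Gp srt] fe pk.
rewrite mulmxA -run_mx_cat; apply: (H e (f :: p)) => //; last by rewrite /= pk.
split; last by rewrite /= fe eqxx.
by move=> h; rewrite inE => /predU1P[-> //|/Gp].
Qed.

Lemma path_form_ineq (R : realType) N m n (A : 'I_m -> 'M[R]_n)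
    (G : {fset 'I_N * 'I_N * seq 'I_m}) k e x :
  (forall p, directed_path G p -> size p = k.+1 ->
    run_mx A (path_word p) = 0) ->
  e \in G -> x != 0 ->
  quad_form (path_form A G k e.1.2) (run_mx A e.2 *m x)
    < quad_form (path_form A G k e.1.1) x.
Proof.
move=> H eG x0; rewrite -[ltRHS]quad_path_form_stationary => [|f p Gp _ pk].
  rewrite quad_path_formS big_mkcond (bigD1_seq e) ?fset_uniq //= eqxx.
  rewrite addrCA ltrDl ltr_pwDl ?quad_form1_gt0 ?sumr_ge0 // => f _.
  by case: ifP => // _; exact: quad_path_form_ge0.
by rewrite H ?mul0mx //= pk.
Qed.

(* In state [i] the letter [w_i] leads to state [i + 1] modulo [n.+1]; [n.+1] is
   meant to be [size w], and the default letter [a0] is then never read. *)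
Definition cycle_mx (R : realType) (m n : nat) (a0 : 'I_m) (w : seq 'I_m)
    (a : 'I_m) : 'M[R]_n.+1 :=
  \matrix_(j, i) ((nth a0 w i == a) && (j == inZp i.+1))%:R.

Definition state (R : realType) (n k : nat) : 'cV[R]_n.+1 :=
  delta_mx (inZp k) 0.

Lemma cycle_mx_state (R : realType) m n (a0 : 'I_m) w a k :
  cycle_mx R n a0 w a *m state R n k =
    (nth a0 w (k %% n.+1) == a)%:R *: state R n k.+1.
Proof.
rewrite -colE; apply/matrixP => j i; rewrite !mxE (ord1 i) eqxx andbT.
rewrite -natrM mulnb; congr (_ && (_ == _))%:R.
by apply/val_inj; rewrite /= -addn1 modnDml addn1.
Qed.

Lemma run_cycle_mx_neq0 (R : realType) m n (a0 : 'I_m) w u k :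
  run_mx (cycle_mx R n a0 w) u *m state R n k != 0 ->
  u = mkseq (fun t => nth a0 w ((k + t) %% n.+1)) (size u).
Proof.
elim: u k => [//|a u IH] k.
rewrite run_mx_cons -mulmxA cycle_mx_state -scalemxAr.
have [<-|_] := eqVneq (nth a0 w (k %% n.+1)) a; last by rewrite scale0r eqxx.
rewrite scale1r => /IH uE /=; rewrite /mkseq /= addn0; congr (_ :: _).
rewrite {1}uE /mkseq (iotaDl 1) -map_comp; apply: eq_map => t /=.
by rewrite addnCA add1n addSn.
Qed.

Lemma infix_cycle m n (a0 : 'I_m) (w : seq 'I_m) k L :
  size w = n.+1 -> (n.+1.*2 <= L)%N ->
  infix w (mkseq (fun t => nth a0 w ((k + t) %% n.+1)) L).
Proof.
move=> wn nL; set u := mkseq _ L.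
pose d := (n.+1 - k %% n.+1)%N.
have dn : (d <= n.+1)%N by exact: leq_subr.
suff -> : w = take n.+1 (drop d u).
  exact: infix_trans (infix_take _ _) (infix_drop _ _).
have uL : size u = L by exact: size_mkseq.
apply: (@eq_from_nth _ a0) => [|t].
  by rewrite size_takel // size_drop uL; lia.
rewrite wn => tn; rewrite nth_take // nth_drop nth_mkseq; last by lia.
congr nth; rewrite {1}(divn_eq k n.+1) /d.
have kn : (k %% n.+1 < n.+1)%N by rewrite ltn_mod.
rewrite (_ : _ + _ = (k %/ n.+1).+1 * n.+1 + t)%N; last by lia.
by rewrite modnMDl modn_small.
Qed.

Lemma run_cycle_mx_eq0 (R : realType) m n (a0 : 'I_m) (w u : seq 'I_m) :
  size w = n.+1 -> (n.+1.*2 <= size u)%N -> ~~ infix w u ->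
  run_mx (cycle_mx R n a0 w) u = 0.
Proof.
move=> wn un wu; apply/matrixP => i j.
have -> : run_mx (cycle_mx R n a0 w) u i j =
    (run_mx (cycle_mx R n a0 w) u *m state R n j) i 0.
  by rewrite /state valZpK -colE mxE.
have [->|/run_cycle_mx_neq0 uE] :=
  eqVneq (run_mx (cycle_mx R n a0 w) u *m state R n j) 0; first by rewrite !mxE.
by case/negP: wu; rewrite uE; exact: infix_cycle.
Qed.

Lemma cycle_mx_unstable (R : realType) m n (a0 : 'I_m) w :
  ~ stable (cycle_mx R n a0 w).
Proof.
pose sigma k := nth a0 w (k %% n.+1).
move=> /(_ sigma (state R n 0)) /cvgr0Pnorm_lt /(_ 1 ltr01) [k _ /(_ k) /=].
have -> : trajectory (cycle_mx R n a0 w) sigma (state R n 0) k = state R n k.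
  elim: k => [//|k /= ->].
  by rewrite cycle_mx_state eqxx scale1r.
move=> /(_ (leqnn k)); rewrite ltNge => /negP; apply.
rewrite [leRHS]mx_normrE; apply: le_trans (le_bigmax _ _ (inZp k, 0)).
by rewrite /= mxE !eqxx normr1.
Qed.

Lemma size_path_word N m (G : {fset 'I_N * 'I_N * seq 'I_m}) p :
  (forall e, e \in G -> e.2 <> [::]) -> {subset p <= G} ->
  (size p <= size (path_word p))%N.
Proof.
move=> G0; elim: p => [//|e p IH] sub.
rewrite /path_word /= size_cat -/(path_word p) -add1n leq_add //.
  by rewrite lt0n size_eq0; apply/eqP/G0/sub/mem_head.
by apply: IH => f fp; apply: sub; rewrite inE fp orbT.
Qed.

Lemma sufficient_path_complete (R : realType) m N
    (S : {fset 'I_N * 'I_N * seq 'I_m}) :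
  (forall s, s \in S -> s.2 <> [::]) ->
  sufficient_condition R S -> path_complete (ineq_graph S).
Proof.
move=> S0 suff w; apply: contrapT => missing.
have G0 e : e \in ineq_graph S -> e.2 <> [::].
  case/imfsetP => /= s /S0 s0 -> /= /(congr1 rev).
  by rewrite revK => /s0.
have {}missing p : directed_path (ineq_graph S) p -> ~~ infix w (path_word p).
  by move=> Gp; apply/negP => wp; apply: missing; exists p.
case: w missing => [/(_ [::])|a0 w' missing].
  by rewrite infix0s => H; suff : false by []; apply: H.
set w := a0 :: w' in missing; set n := size w'.
apply: (@cycle_mx_unstable R m n a0 w); apply: suff => //.
pose A := cycle_mx R n a0 w.
exists (path_form A (ineq_graph S) n.+1.*2); split => [i|].
  exact: path_form_posdef.
move=> [[i j] u] uS x x0.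
have := @path_form_ineq R N m _ A (ineq_graph S) n.+1.*2 (i, j, rev u) x.
rewrite /= /run_mx revK; apply => // [p Gp pn|].
  apply: run_cycle_mx_eq0 => //; last exact: missing.
  by apply: leq_trans (size_path_word G0 Gp.1); rewrite pn.
by apply/imfsetP; exists (i, j, u).
Qed.

Theorem theorem3 (R : realType) (m N : nat) (S : {fset 'I_N * 'I_N * seq 'I_m})
    (m_gt0 : (0 < m)%N)
    (S_words : forall s, s \in S -> s.2 <> [::]) :
  sufficient_condition R S <-> path_complete (ineq_graph S).
Proof.
split; first exact: sufficient_path_complete.
exact: path_complete_sufficient.
Qed.
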